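(* The only additive means that are homogeneous are the power means. That is, an additive mean $M$ is homogeneous if and only if $M=\pi_r$ for some $r\in\mathbb{R}$.
   Context: A mean is a function $M:(0,+\infty)^2\to(0,+\infty)$ of class $C^\infty$ such that $\min(x,y)\le M(x,y)\le\max(x,y)$ and $M(x,y)=M(y,x)$ for all $x,y>0$. A mean $M$ is additive if there is a strictly monotonic and infinitely differentiable function $f:(0,+\infty)\to\mathbb{R}$ such that $M(x,y)=f^{-1}\left(\frac{f(x)+f(y)}{2}\right)$ for all $x,y>0$. A mean $M$ is homogeneous if $M(\lambda x,\lambda y)=\lambda M(x,y)$ for all $\lambda,x,y>0$. The power means are $\pi_r(x,y)=\left(\frac{x^r+y^r}{2}\right)^{1/r}$ for $r\in\mathbb{R}\setminus\{0\}$, and $\pi_0(x,y)=\sqrt{xy}$. *)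

(* Defs.v *)
From Stdlib Require Import Reals.
From Coquelicot Require Import Coquelicot.
Open Scope R_scope.

(** Functions on (0, +oo) and on its square are total functions on [R], of
    which only the values at positive arguments matter.  Since these domains
    are open, derivatives at positive arguments do not depend on the values
    elsewhere. *)

(** [ex_diff_n M n x y]: the iterated partial derivatives of [M] up to order
    [n], in any order of the variables, exist and are continuous at [(x, y)]. *)
Definition smooth2_pos (M : R -> R -> R) : Prop :=
  forall (n : nat) (x y : R), 0 < x -> 0 < y -> ex_diff_n M n x y.

Definition smooth_pos (f : R -> R) : Prop :=
  forall (n : nat) (x : R), 0 < x -> ex_derive_n f n x.

Record is_mean (M : R -> R -> R) : Prop := {
  mean_pos : forall x y : R, 0 < x -> 0 < y -> 0 < M x y;
  mean_smooth : smooth2_pos M;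
  mean_bounds : forall x y : R, 0 < x -> 0 < y ->
    Rmin x y <= M x y <= Rmax x y;
  mean_sym : forall x y : R, 0 < x -> 0 < y -> M x y = M y x
}.

Definition strictly_monotonic_pos (f : R -> R) : Prop :=
  (forall x y : R, 0 < x -> x < y -> f x < f y) \/
  (forall x y : R, 0 < x -> x < y -> f y < f x).

(** [g] is the inverse of [f] restricted to (0, +oo): this determines [g]
    exactly on the image of (0, +oo) under [f]. *)
Definition is_inverse_pos (f g : R -> R) : Prop :=
  forall x : R, 0 < x -> g (f x) = x.

(** For continuous [f], the point [(f x + f y) / 2] lies in the image of
    (0, +oo) under [f], so the choice of [g] outside that image is irrelevant. *)
Definition additive (M : R -> R -> R) : Prop :=
  exists f g : R -> R,
    strictly_monotonic_pos f /\ smooth_pos f /\ is_inverse_pos f g /\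
    forall x y : R, 0 < x -> 0 < y -> M x y = g ((f x + f y) / 2).

Definition homogeneous (M : R -> R -> R) : Prop :=
  forall l x y : R, 0 < l -> 0 < x -> 0 < y -> M (l * x) (l * y) = l * M x y.

Definition power_mean (r x y : R) : R :=
  if Req_dec_T r 0 then sqrt (x * y)
  else Rpower ((Rpower x r + Rpower y r) / 2) (1 / r).

(* Main.v *)
Require Import Defs.
From Stdlib Require Import Reals Lra.
From Coquelicot Require Import Coquelicot.
Open Scope R_scope.

(** Let [M] be a homogeneous mean with generator [f], so that
    [f (M x y) = (f x + f y) / 2].  Write [P x y] for the partial derivative of
    [M] in its first variable; by symmetry the one in the second variable is
    [P y x].  Differentiating the generator equation gives
    [f' (M x y) * P x y = f' x / 2] and [f' (M x y) * P y x = f' y / 2], so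
    [P x y : P y x = f' x : f' y].  The derivatives of a function which is
    homogeneous of degree 1 are homogeneous of degree 0, hence
    [f' (l x) : f' (l y) = f' x : f' y] for every [l > 0]
    ([generator_derive_proportional]).

    Some [f' x0] is nonzero because [f] is not constant.  Then [P x0 x] is
    nonzero for every [x], even where [f'] might vanish a priori, so that the
    proportions can be cleared; they show that [f'] vanishes nowhere and that
    [f' / f' 1] is multiplicative.  A differentiable multiplicative function is
    a power ([multiplicative_is_power]), so [f'] is a constant multiple of
    [x ^ s] and [f] is an affine function of [x ^ (s + 1)], or of [ln x] when
    [s = -1].  An affine change of generator does not change the mean
    ([proportional_derivative_generates]), so [M] is the power mean of
    exponent [s + 1]. *)

(** * Calculus on the positive half-line *)

Lemma locally_pos (x : R) : 0 < x -> locally x (fun t => 0 < t).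
Proof. intros Hx. apply (open_gt 0 x Hx). Qed.

Lemma is_derive_zero_constant_pos (F : R -> R) :
  (forall x, 0 < x -> is_derive F x 0) ->
  forall x y, 0 < x -> 0 < y -> F x = F y.
Proof.
  intros HF.
  assert (Hlt : forall x y, 0 < x -> x < y -> F x = F y).
  { intros x y Hx Hxy. apply (eq_is_derive F x y); [|exact Hxy].
    intros t Ht. apply HF. lra. }
  intros x y Hx Hy. destruct (Rtotal_order x y) as [H|[H|H]].
  - now apply Hlt.
  - now rewrite H.
  - symmetry. now apply Hlt.
Qed.

Lemma is_derive_Rpower (r x : R) :
  0 < x -> is_derive (fun t => Rpower t r) x (r * Rpower x (r - 1)).
Proof. intros Hx. apply is_derive_Reals. now apply derivable_pt_lim_power. Qed.

Lemma is_derive_ln_pos (x : R) : 0 < x -> is_derive ln x (/ x).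
Proof. intros Hx. apply is_derive_Reals. now apply derivable_pt_lim_ln. Qed.

(** Differentiating [u (t * x) = u t * u x] in [t] at [t = 1] gives Euler's
    equation [x * u' x = u' 1 * u x], whose solutions are the multiples of
    [x ^ u' 1]. *)
Lemma multiplicative_is_power (u : R -> R) :
  (forall x, 0 < x -> ex_derive u x) ->
  u 1 = 1 ->
  (forall x y, 0 < x -> 0 < y -> u (x * y) = u x * u y) ->
  forall x, 0 < x -> u x = Rpower x (Derive u 1).
Proof.
  intros Du u1 umul x Hx. set (s := Derive u 1).
  assert (Euler : forall t, 0 < t -> t * Derive u t = s * u t).
  { intros t Ht.
    assert (D1 : is_derive (fun l => u (l * t)) 1 (t * Derive u t)).
    { apply (is_derive_comp u (fun l => l * t)).
      - replace (1 * t) with t by ring. now apply Derive_correct, Du.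
      - auto_derive; [exact I | ring]. }
    assert (D2 : is_derive (fun l => u (l * t)) 1 (s * u t)).
    { apply (is_derive_ext_loc (fun l => u l * u t)).
      - refine (filter_imp _ _ _ (locally_pos 1 Rlt_0_1)).
        intros l Hl. symmetry. now apply umul.
      - auto_derive; [apply Du; lra | now rewrite Rmult_1_l]. }
    rewrite <- (is_derive_unique _ _ _ D1). exact (is_derive_unique _ _ _ D2). }
  assert (Hconst : u x * Rpower x (- s) = u 1 * Rpower 1 (- s)).
  { apply (is_derive_zero_constant_pos (fun t => u t * Rpower t (- s)));
      [|exact Hx|lra].
    intros t Ht.
    replace 0 with (Derive u t * Rpower t (- s)
                    + u t * (- s * Rpower t (- s - 1))).
    - apply (is_derive_mult u (fun t => Rpower t (- s))).
      + now apply Derive_correct, Du.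
      + now apply is_derive_Rpower.
      + exact Rmult_comm.
    - replace (Rpower t (- s)) with (t * Rpower t (- s - 1)).
      + transitivity (Rpower t (- s - 1) * (t * Derive u t - s * u t)); [ring|].
        rewrite Euler by exact Ht. ring.
      + rewrite <- (Rpower_1 t Ht) at 1. rewrite <- Rpower_plus.
        f_equal. ring. }
  unfold Rpower at 2 in Hconst. rewrite u1, ln_1, Rmult_0_r, exp_0 in Hconst.
  rewrite Rpower_Ropp in Hconst.
  assert (Hp : 0 < Rpower x s) by apply exp_pos.
  apply (Rmult_eq_reg_r (/ Rpower x s)); [|apply Rinv_neq_0_compat; lra].
  rewrite Hconst. field. lra.
Qed.

(** * Generators of a mean *)

Lemma midpoint_value (f : R -> R) (x y : R) :
  x < y -> (forall t, x <= t <= y -> ex_derive f t) ->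
  exists z, x <= z <= y /\ f z = (f x + f y) / 2.
Proof.
  intros Hxy Df. set (m := (f x + f y) / 2).
  assert (Cf : forall c t, x <= t <= y ->
            continuity_pt (fun t => c * (f t - m)) t).
  { intros c t Ht. apply continuity_pt_filterlim.
    apply (ex_derive_continuous (fun t => c * (f t - m))).
    auto_derive. now apply Df. }
  destruct (Rtotal_order (f x) (f y)) as [H|[H|H]].
  - destruct (Ranalysis5.IVT_interv (fun t => 1 * (f t - m)) x y (Cf 1) Hxy)
      as [z [Hz Ez]]; try (unfold m; lra).
    exists z. split; [exact Hz | lra].
  - exists x. unfold m. lra.
  - destruct (Ranalysis5.IVT_interv (fun t => -1 * (f t - m)) x y (Cf (-1)) Hxy)
      as [z [Hz Ez]]; try (unfold m; lra).
    exists z. split; [exact Hz | lra].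
Qed.

Definition generates (f : R -> R) (M : R -> R -> R) : Prop :=
  forall x y, 0 < x -> 0 < y -> f (M x y) = (f x + f y) / 2.

(** The midpoint of [f x] and [f y] is a value [f z] by the intermediate value
    theorem, so the left inverse [g] of [f] is also a right inverse there. *)
Lemma inverse_formula_generates (M : R -> R -> R) (f g : R -> R) :
  (forall x, 0 < x -> ex_derive f x) ->
  is_inverse_pos f g ->
  (forall x y, 0 < x -> 0 < y -> M x y = g ((f x + f y) / 2)) ->
  generates f M.
Proof.
  intros Df Hg HM x y Hx Hy. rewrite HM by assumption.
  assert (Hz : exists z, 0 < z /\ f z = (f x + f y) / 2).
  { destruct (Rtotal_order x y) as [H|[H|H]].
    - destruct (midpoint_value f x y H) as [z [Hz Ez]].
      + intros t Ht. apply Df. lra.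
      + exists z. split; [lra | exact Ez].
    - exists x. rewrite <- H. split; [exact Hx | lra].
    - destruct (midpoint_value f y x H) as [z [Hz Ez]].
      + intros t Ht. apply Df. lra.
      + exists z. split; lra. }
  destruct Hz as [z [Hz Ez]]. rewrite <- Ez. now rewrite Hg.
Qed.

(** Here [f = c * k + d], and the generator equation is invariant under affine
    changes of the generator. *)
Lemma proportional_derivative_generates
  (M : R -> R -> R) (f k k' : R -> R) (c : R) :
  (forall x y, 0 < x -> 0 < y -> 0 < M x y) ->
  c <> 0 ->
  (forall x, 0 < x -> is_derive k x (k' x)) ->
  (forall x, 0 < x -> is_derive f x (c * k' x)) ->
  generates f M -> generates k M.
Proof.
  intros Mpos Hc Dk Df HM x y Hx Hy.
  assert (Hf : forall t, 0 < t -> f t = c * k t + (f 1 - c * k 1)).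
  { intros t Ht.
    enough (f t - c * k t = f 1 - c * k 1) by lra.
    apply (is_derive_zero_constant_pos (fun t => f t - c * k t));
      [|exact Ht|lra].
    intros v Hv. replace 0 with (c * k' v - c * k' v) by ring.
    apply (is_derive_minus f (fun t => c * k t)); [now apply Df|].
    now apply is_derive_scal, Dk. }
  specialize (HM x y Hx Hy).
  rewrite (Hf (M x y)), (Hf x), (Hf y) in HM by auto.
  apply (Rmult_eq_reg_l c); [lra | exact Hc].
Qed.

Lemma strictly_monotonic_derive_neq_0 (f : R -> R) :
  strictly_monotonic_pos f ->
  (forall x, 0 < x -> ex_derive f x) ->
  exists x, 0 < x /\ Derive f x <> 0.
Proof.
  intros Hmono Df.
  destruct (MVT_gen f 1 2 (Derive f)) as [x [Hx Ex]].
  - intros x Hx. rewrite Rmin_left in Hx by lra. apply Derive_correct, Df. lra.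
  - intros x Hx. rewrite Rmin_left in Hx by lra.
    apply continuity_pt_filterlim, (ex_derive_continuous f), Df. lra.
  - rewrite Rmin_left in Hx by lra. exists x. split; [lra|].
    intros E. rewrite E in Ex.
    destruct Hmono as [H|H]; specialize (H 1 2); lra.
Qed.

(** * Homogeneous means *)

Definition partial1 (M : R -> R -> R) (x y : R) : R := Derive (fun t => M t y) x.

Lemma homogeneous_partial1 (M : R -> R -> R) :
  (forall x y, 0 < x -> 0 < y -> ex_derive (fun t => M t y) x) ->
  homogeneous M ->
  forall l x y, 0 < l -> 0 < x -> 0 < y ->
  partial1 M (l * x) (l * y) = partial1 M x y.
Proof.
  intros DM HM l x y Hl Hx Hy.
  assert (Hlx : 0 < l * x) by now apply Rmult_lt_0_compat.
  assert (Hly : 0 < l * y) by now apply Rmult_lt_0_compat.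
  assert (D1 : is_derive (fun t => M (l * t) (l * y)) x
                 (l * partial1 M (l * x) (l * y))).
  { apply (is_derive_comp (fun s => M s (l * y)) (fun t => l * t)).
    - now apply Derive_correct, DM.
    - auto_derive; [exact I | ring]. }
  assert (D2 : is_derive (fun t => M (l * t) (l * y)) x (l * partial1 M x y)).
  { apply (is_derive_ext_loc (fun t => l * M t y)).
    - refine (filter_imp _ _ _ (locally_pos x Hx)).
      intros t Ht. symmetry. now apply HM.
    - now apply is_derive_scal, Derive_correct, DM. }
  apply (Rmult_eq_reg_l l); [|lra].
  rewrite <- (is_derive_unique _ _ _ D1). exact (is_derive_unique _ _ _ D2).
Qed.

Lemma generates_partial1 (M : R -> R -> R) (f : R -> R) :
  (forall x y, 0 < x -> 0 < y -> 0 < M x y) ->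
  (forall x y, 0 < x -> 0 < y -> ex_derive (fun t => M t y) x) ->
  (forall x, 0 < x -> ex_derive f x) ->
  generates f M ->
  forall x y, 0 < x -> 0 < y ->
  partial1 M x y * Derive f (M x y) = Derive f x / 2.
Proof.
  intros Mpos DM Df HM x y Hx Hy.
  assert (D1 : is_derive (fun t => f (M t y)) x
                 (partial1 M x y * Derive f (M x y))).
  { apply (is_derive_comp f (fun t => M t y)).
    - now apply Derive_correct, Df, Mpos.
    - now apply Derive_correct, DM. }
  assert (D2 : is_derive (fun t => f (M t y)) x (Derive f x / 2)).
  { apply (is_derive_ext_loc (fun t => (f t + f y) / 2)).
    - refine (filter_imp _ _ _ (locally_pos x Hx)).
      intros t Ht. symmetry. now apply HM.
    - auto_derive; [now apply Df | now rewrite Rmult_1_l]. }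
  rewrite <- (is_derive_unique _ _ _ D1). exact (is_derive_unique _ _ _ D2).
Qed.

(** Both sides describe the ratio of the two partial derivatives of [M], at
    [(l x, l y)] and at [(x, y)] respectively.  The hypothesis
    [Derive f y <> 0] makes the partial derivative [partial1 M y x] nonzero,
    by which the ratio is cleared. *)
Lemma generator_derive_proportional (M : R -> R -> R) (f : R -> R) :
  is_mean M -> homogeneous M ->
  (forall x, 0 < x -> ex_derive f x) ->
  generates f M ->
  forall l x y, 0 < l -> 0 < x -> 0 < y -> Derive f y <> 0 ->
  Derive f (l * x) * Derive f y = Derive f (l * y) * Derive f x.
Proof.
  intros mean_M HM Df HG l x y Hl Hx Hy Hfy.
  pose proof (mean_pos M mean_M) as Mpos.
  assert (DM : forall x y, 0 < x -> 0 < y -> ex_derive (fun t => M t y) x).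
  { intros a b Ha Hb. now apply (mean_smooth M mean_M 1%nat a b Ha Hb). }
  assert (ratio : forall a b, 0 < a -> 0 < b ->
            partial1 M a b * Derive f b = partial1 M b a * Derive f a).
  { intros a b Ha Hb.
    pose proof (generates_partial1 M f Mpos DM Df HG a b Ha Hb) as E1.
    pose proof (generates_partial1 M f Mpos DM Df HG b a Hb Ha) as E2.
    rewrite (mean_sym M mean_M b a Hb Ha) in E2.
    replace (Derive f a) with (2 * (partial1 M a b * Derive f (M a b))) by lra.
    replace (Derive f b) with (2 * (partial1 M b a * Derive f (M a b))) by lra.
    ring. }
  assert (Hlx : 0 < l * x) by now apply Rmult_lt_0_compat.
  assert (Hly : 0 < l * y) by now apply Rmult_lt_0_compat.
  assert (Hp : partial1 M y x <> 0).
  { intros E. pose proof (generates_partial1 M f Mpos DM Df HG y x Hy Hx) as E1.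
    rewrite E in E1. lra. }
  pose proof (ratio x y Hx Hy) as R1.
  pose proof (ratio (l * x) (l * y) Hlx Hly) as R2.
  rewrite !(homogeneous_partial1 M DM HM) in R2 by assumption.
  apply (Rmult_eq_reg_l (partial1 M y x)); [|exact Hp].
  transitivity (partial1 M x y * Derive f (l * y) * Derive f y);
    [rewrite R2; ring|].
  transitivity (partial1 M x y * Derive f y * Derive f (l * y)); [ring|].
  rewrite R1. ring.
Qed.

Lemma homogeneous_generator_derive (M : R -> R -> R) (f : R -> R) :
  is_mean M -> homogeneous M ->
  strictly_monotonic_pos f -> smooth_pos f -> generates f M ->
  exists c s, c <> 0 /\ forall x, 0 < x -> is_derive f x (c * Rpower x s).
Proof.
  intros mean_M HM Hmono Hf HG.
  assert (Df : forall x, 0 < x -> ex_derive f x) by exact (Hf 1%nat).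
  assert (D2f : forall x, 0 < x -> ex_derive (Derive f) x) by exact (Hf 2%nat).
  pose proof (generator_derive_proportional M f mean_M HM Df HG) as prop.
  destruct (strictly_monotonic_derive_neq_0 f Hmono Df) as [x0 [Hx0 Hf0]].
  assert (Hf1 : Derive f 1 <> 0).
  { intros E.
    (* Scaling the pair (1, x0) by x0 makes [f' x0 * f' x0] a multiple of [f' 1]. *)
    pose proof (prop x0 1 x0 Hx0 Rlt_0_1 Hx0 Hf0) as H.
    rewrite Rmult_1_r, E, Rmult_0_r in H.
    apply Rmult_integral in H. tauto. }
  set (u := fun x => Derive f x / Derive f 1).
  exists (Derive f 1), (Derive u 1). split; [exact Hf1|].
  intros x Hx. rewrite <- (multiplicative_is_power u).
  - replace (Derive f 1 * u x) with (Derive f x) by (unfold u; field; exact Hf1).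
    now apply Derive_correct, Df.
  - intros t Ht. unfold u. auto_derive. now apply D2f.
  - unfold u. field. exact Hf1.
  - intros a b Ha Hb. unfold u.
    pose proof (prop a b 1 Ha Hb Rlt_0_1 Hf1) as H.
    rewrite Rmult_1_r in H.
    apply (Rmult_eq_reg_r (Derive f 1 * Derive f 1));
      [|now apply Rmult_integral_contrapositive_currified].
    field_simplify; [|exact Hf1|exact Hf1]. rewrite H. ring.
  - exact Hx.
Qed.

(** * Power means *)

Lemma Rpower_generates_power_mean (M : R -> R -> R) (r : R) :
  r <> 0 ->
  (forall x y, 0 < x -> 0 < y -> 0 < M x y) ->
  generates (fun t => Rpower t r) M ->
  forall x y, 0 < x -> 0 < y -> M x y = power_mean r x y.
Proof.
  intros Hr Mpos HG x y Hx Hy. unfold power_mean.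
  destruct (Req_dec_T r 0) as [E|_]; [contradiction|].
  rewrite <- (HG x y Hx Hy), Rpower_mult.
  replace (r * (1 / r)) with 1 by (field; exact Hr).
  symmetry. now apply Rpower_1, Mpos.
Qed.

Lemma ln_generates_geometric_mean (M : R -> R -> R) :
  (forall x y, 0 < x -> 0 < y -> 0 < M x y) ->
  generates ln M ->
  forall x y, 0 < x -> 0 < y -> M x y = power_mean 0 x y.
Proof.
  intros Mpos HG x y Hx Hy. unfold power_mean.
  destruct (Req_dec_T 0 0) as [_|E]; [|contradiction].
  rewrite <- Rpower_sqrt by now apply Rmult_lt_0_compat.
  unfold Rpower. rewrite ln_mult by assumption.
  replace (/ 2 * (ln x + ln y)) with ((ln x + ln y) / 2) by field.
  rewrite <- (HG x y Hx Hy). symmetry. now apply exp_ln, Mpos.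
Qed.

Lemma power_mean_homogeneous (r : R) : homogeneous (power_mean r).
Proof.
  intros l x y Hl Hx Hy. unfold power_mean.
  destruct (Req_dec_T r 0) as [_|Hr].
  - replace (l * x * (l * y)) with (l * l * (x * y)) by ring.
    rewrite sqrt_mult by (apply Rlt_le; now apply Rmult_lt_0_compat).
    now rewrite sqrt_square by lra.
  - rewrite <- !Rpower_mult_distr by assumption.
    assert (Hpos : forall t, 0 < Rpower t r) by (intros; apply exp_pos).
    replace ((Rpower l r * Rpower x r + Rpower l r * Rpower y r) / 2)
      with (Rpower l r * ((Rpower x r + Rpower y r) / 2)) by field.
    rewrite <- Rpower_mult_distr;
      [|apply Hpos | pose proof (Hpos x); pose proof (Hpos y); lra].
    rewrite Rpower_mult.
    replace (r * (1 / r)) with 1 by (field; exact Hr).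
    now rewrite Rpower_1.
Qed.

Theorem theorem3p17 (M : R -> R -> R) (mean_M : is_mean M) (additive_M : additive M) :
  homogeneous M <->
  exists r : R, forall x y : R, 0 < x -> 0 < y -> M x y = power_mean r x y.
Proof.
  split.
  - intros HM. destruct additive_M as [f [g [Hmono [Hf [Hg Hfg]]]]].
    pose proof (mean_pos M mean_M) as Mpos.
    pose proof (inverse_formula_generates M f g (Hf 1%nat) Hg Hfg) as HG.
    destruct (homogeneous_generator_derive M f mean_M HM Hmono Hf HG)
      as [c [s [Hc Df]]].
    exists (s + 1). destruct (Req_dec_T (s + 1) 0) as [E|E].
    + rewrite E. apply ln_generates_geometric_mean; [exact Mpos|].
      apply (proportional_derivative_generates M f ln Rinv c); try assumption.
      * exact is_derive_ln_pos.
      * intros x Hx.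
        replace (/ x) with (Rpower x s); [now apply Df|].
        replace s with (- (1)) by lra. now rewrite Rpower_Ropp, Rpower_1.
    + apply Rpower_generates_power_mean; [exact E | exact Mpos |].
      apply (proportional_derivative_generates M f _
               (fun x => (s + 1) * Rpower x (s + 1 - 1)) (c / (s + 1)));
        try assumption.
      * unfold Rdiv. now apply Rmult_integral_contrapositive_currified;
          [|apply Rinv_neq_0_compat].
      * intros x Hx. now apply is_derive_Rpower.
      * intros x Hx.
        replace (s + 1 - 1) with s by ring.
        replace (c / (s + 1) * ((s + 1) * Rpower x s)) with (c * Rpower x s)
          by (field; exact E).
        now apply Df.
  - intros [r Hr] l x y Hl Hx Hy.
    rewrite !Hr by (try assumption; now apply Rmult_lt_0_compat).
    now apply power_mean_homogeneous.
Qed.
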